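(* Let $G$ be a finite simple graph with $\alpha(G)\ge 2$. If $G$ contains no induced cycle $C_\ell$ for any $\ell$ with $4\le \ell\le 2\alpha(G)$, then $G$ contains the complete graph $K_{\chi(G)}$ as an immersion.
   Context: $\alpha(G)$ is the independence number and $\chi(G)$ the chromatic number. A graph $G$ contains a graph $K$ as an immersion if there is an injective map $\phi\colon V(K)\to V(G)$ such that for every edge $uv\in E(K)$ there is a path $P_{uv}$ in $G$ with endpoints $\phi(u),\phi(v)$, the paths $P_{uv}$ ($uv\in E(K)$) are pairwise edge-disjoint, and no vertex of $\phi(V(K))$ (the branch vertices) is an interior vertex of any path $P_{uv}$. *)

(* Defs.v *)
From HB Require Import structures.
From mathcomp Require Import all_boot.
Set Implicit Arguments.
Unset Strict Implicit.
Unset Printing Implicit Defensive.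

Record sgraph := SGraph {
  vertex :> finType;
  adj : rel vertex;
  adj_sym : symmetric adj;
  adj_irr : irreflexive adj }.

Definition edges (G : sgraph) : {set {set G}} :=
  [set e : {set G} | [exists u, exists v, adj u v && (e == [set u; v])]].

Definition independent (G : sgraph) (A : {set G}) : bool :=
  [forall x in A, forall y in A, ~~ adj x y].

Definition alpha (G : sgraph) : nat :=
  \max_(A : {set G} | independent A) #|A|.

Definition proper_coloring (G : sgraph) (k : nat) (c : {ffun G -> 'I_k}) : bool :=
  [forall x, forall y, adj x y ==> (c x != c y)].

Definition colorable (G : sgraph) (k : nat) : bool :=
  [exists c : {ffun G -> 'I_k}, proper_coloring c].

Lemma colorable_card (G : sgraph) : exists k, colorable G k.
Proof.
exists #|{: G}|; apply/existsP; exists [ffun x => enum_rank x].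
apply/forallP => x; apply/forallP => y; apply/implyP => xy.
rewrite !ffunE; apply/eqP => /enum_rank_inj eq_xy.
by rewrite eq_xy adj_irr in xy.
Qed.

Definition chi (G : sgraph) : nat := ex_minn (colorable_card G).

Definition complete_rel (n : nat) : rel 'I_n := fun i j => i != j.

Lemma complete_rel_sym n : symmetric (@complete_rel n).
Proof. by move=> i j; rewrite /complete_rel eq_sym. Qed.

Lemma complete_rel_irr n : irreflexive (@complete_rel n).
Proof. by move=> i; rewrite /complete_rel eqxx. Qed.

Definition complete_graph (n : nat) : sgraph :=
  SGraph (@complete_rel_sym n) (@complete_rel_irr n).

(* The conjunct i != j only matters for n = 1, where ordS i = i. *)
Definition cycle_rel (n : nat) : rel 'I_n :=
  fun i j => (i != j) && ((j == ordS i) || (i == ordS j)).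

Lemma cycle_rel_sym n : symmetric (@cycle_rel n).
Proof. by move=> i j; rewrite /cycle_rel eq_sym orbC. Qed.

Lemma cycle_rel_irr n : irreflexive (@cycle_rel n).
Proof. by move=> i; rewrite /cycle_rel eqxx. Qed.

(* The cycle C_n, meaningful for n >= 3. *)
Definition cycle_graph (n : nat) : sgraph :=
  SGraph (@cycle_rel_sym n) (@cycle_rel_irr n).

Definition contains_induced (G H : sgraph) : Prop :=
  exists f : H -> G, injective f /\ forall x y, adj (f x) (f y) = adj x y.

(* A path is the sequence of all its vertices, both endpoints included. *)
Definition is_path (G : sgraph) (s : seq G) : bool :=
  [&& s != [::], sorted (@adj G) s & uniq s].

Definition path_ends (G : sgraph) (s : seq G) : {set G} :=
  if s is x :: s' then [set x; last x s'] else set0.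

Definition path_interior (G : sgraph) (s : seq G) : seq G :=
  if s is x :: s' then behead (belast x s') else [::].

Definition path_edges (G : sgraph) (s : seq G) : seq {set G} :=
  if s is x :: s' then pairmap (fun y z => [set y; z]) x s' else [::].

(* Edges of K are two-element sets, so that each edge gets a single path; the
   direction in which the sequence P e runs is immaterial. *)
Definition contains_immersion (G K : sgraph) : Prop :=
  exists (phi : K -> G) (P : {set K} -> seq G),
    [/\ injective phi,
        forall e, e \in edges K ->
          is_path (P e) /\ path_ends (P e) = [set phi v | v in e],
        forall e e', e \in edges K -> e' \in edges K -> e != e' ->
          forall d, d \in path_edges (P e) -> d \notin path_edges (P e')
      & forall e, e \in edges K ->
          forall v : K, phi v \notin path_interior (P e)].

(* Main.v *)
(* Every induced cycle has length at most 2 alpha + 1, so either G is chordal,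
   and then its chromatic number is its clique number, or G has an induced
   cycle of length N = 2 alpha + 1.  In the latter case the absence of shorter
   holes and the bound on independent sets force G to be a clique joined to all
   vertices of a blow-up of C_N, with cliques V_0, ..., V_(N-1) as layers.  Let
   V_0 be a smallest layer and assume that the chromatic number chi exceeds the
   clique number.  An explicit colouring shows that the dominating clique
   together with V_0, V_1 and any even layer other than V_0 has at least chi
   vertices.  So the dominating clique, V_0, V_1 and b vertices of V_2, chi
   vertices in total, serve as branch vertices: the only missing adjacencies,
   between V_2 and V_0, are replaced by paths through V_3, ..., V_(N-1), where
   each odd layer contains a copy of V_0 and each even layer a copy of the b
   chosen vertices of V_2. *)

Require Import Defs.
From mathcomp Require Import all_boot zify.
Set Implicit Arguments.
Unset Strict Implicit.
Unset Printing Implicit Defensive.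

(* With closed adjacency a vertex of the hole and its twins off the hole are
   described by the same equations. *)
Definition cadj (G : sgraph) (x y : G) : bool := (x == y) || adj x y.

(** Closed adjacency in the cycle C_N, spelled out without [%%] so that [lia] decides its
    instances. *)
Definition cyc (N i j : nat) : bool :=
  [|| i == j, i.+1 == j, j.+1 == i, (i == 0) && (j.+1 == N)
    | (j == 0) && (i.+1 == N)].

Definition hole (G : sgraph) (N : nat) (f : nat -> G) : Prop :=
  forall i j, i < N -> j < N -> cadj (f i) (f j) = cyc N i j.

Definition clique (G : sgraph) (A : {set G}) : Prop :=
  forall x y, x \in A -> y \in A -> cadj x y.

Lemma cycC N i j : cyc N i j = cyc N j i.
Proof. by rewrite /cyc; lia. Qed.

Lemma cyc_modn N i j : i < N -> j < N ->
  cyc N i j = [|| i == j, j == i.+1 %% N | i == j.+1 %% N].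
Proof.
have S a : a < N -> a.+1 %% N = if a.+1 == N then 0 else a.+1.
  by move=> aN; case: eqP => [->|?]; rewrite ?modnn // modn_small //; lia.
by move=> iN jN; rewrite !S // /cyc; case: (i.+1 =P N); case: (j.+1 =P N); lia.
Qed.

(** * Holes and the independence number *)

Section Graph.

Variable G : sgraph.
Implicit Types (x y z u v w : G) (U : {set G}) (f : nat -> G).

Lemma cadjC x y : cadj x y = cadj y x.
Proof. by rewrite /cadj eq_sym adj_sym. Qed.

Lemma cadj_refl x : cadj x x.
Proof. by rewrite /cadj eqxx. Qed.

Lemma adjE x y : adj x y = (x != y) && cadj x y.
Proof. by rewrite /cadj; case: eqVneq => [->|] //=; rewrite adj_irr. Qed.

Lemma adj_cadj x y : adj x y -> cadj x y.
Proof. by rewrite adjE => /andP[]. Qed.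

(** For N at least 4, distinct positions of the cycle have distinct closed neighbourhoods. For a
    triangle this fails: a constant [f] would qualify as a hole. *)
Lemma hole_inj N f i j :
  4 <= N -> hole N f -> i < N -> j < N -> f i = f j -> i = j.
Proof.
move=> N4 hf.
wlog lt_ij : i j / i < j => [wl iN jN eq_ij|iN jN eq_ij].
  by case: (ltngtP i j) => // h; [|symmetry]; apply: wl.
have E (a : nat) : a < N -> cyc N i a = cyc N j a.
  by move=> aN; rewrite -!hf ?eq_ij.
have [ji|[i0 jN']] : j = i.+1 \/ i = 0 /\ j = N.-1.
- by move: (E i iN); rewrite /cyc eqxx; lia.
- have [h|h] := ltnP i.+2 N.
  + by move: (E i.+2 h); rewrite /cyc; lia.
  + by move: (E i.-1); rewrite /cyc; lia.
- by move: (E 1); rewrite /cyc; lia.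
Qed.

Lemma hole_induced N f :
  4 <= N -> hole N f -> contains_induced G (cycle_graph N).
Proof.
move=> N4 hf; exists (fun i : 'I_N => f i); split.
  by move=> i j /(hole_inj N4 hf (ltn_ord i) (ltn_ord j)) /val_inj.
move=> i j; rewrite adjE /= hf //.
have -> : (f i != f j) = (i != j).
  congr negb; apply/eqP/eqP => [|->] //.
  by move/(hole_inj N4 hf (ltn_ord i) (ltn_ord j)); apply: val_inj.
by rewrite cyc_modn // /cycle_rel -!val_eqE /=; case: eqP.
Qed.

Lemma alpha_geq n f :
  (forall i j, i < j -> j < n -> ~~ cadj (f i) (f j)) -> n <= alpha G.
Proof.
move=> indep_f.
have indep i j : i < n -> j < n -> i != j -> ~~ cadj (f i) (f j).
  move=> iN jN; case: ltngtP => // ij _; first exact: indep_f.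
  by rewrite cadjC indep_f.
pose A := [set f i | i : 'I_n].
have -> : n = #|A|.
  rewrite card_imset ?card_ord // => i j eq_ij; apply/val_inj/eqP => /=.
  by apply: contraTT (cadj_refl (f i)) => ne_ij; rewrite {2}eq_ij indep.
rewrite /alpha; apply: (leq_bigmax_cond (F := fun A : {set G} => #|A|)).
apply/forall_inP => _ /imsetP[i _ ->]; apply/forall_inP => _ /imsetP[j _ ->].
have [->|ne_ij] := eqVneq i j; first by rewrite adj_irr.
by apply: contra (@indep i j (ltn_ord i) (ltn_ord j) ne_ij); apply: adj_cadj.
Qed.

(** Every second vertex of the hole, [N./2] in all, gives an independent set. *)
Lemma hole_alpha N f : 4 <= N -> hole N f -> N <= (alpha G).*2.+1.
Proof.
move=> N4 hf; suff: N./2 <= alpha G by lia.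
apply: (@alpha_geq _ (fun i => f i.*2)) => i j ij jN.
by rewrite hf /cyc; lia.
Qed.

Lemma colorable_of_nat c (col : G -> nat) :
  (forall x, col x < c) -> (forall x y, adj x y -> col x != col y) ->
  colorable G c.
Proof.
move=> colc colP; apply/existsP; exists [ffun x => Ordinal (colc x)].
apply/forallP => x; apply/forallP => y; apply/implyP => xy.
by rewrite !ffunE -val_eqE /= colP.
Qed.

End Graph.

(** * Chordal graphs *)

Section Chordal.

Variable G : sgraph.
Implicit Types (x y z u v w : G) (U X : {set G}) (p : nat -> G).

(** Shortcut a walk at a repeated vertex or a chord until none is left; the length [t] drops each
    time. *)
Lemma induced_path X x y t p :
  p 0 = x -> p t = y -> (forall i, i <= t -> p i \in X) ->
  (forall i, i < t -> adj (p i) (p i.+1)) ->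
  exists t' q, [/\ q 0 = x, q t' = y, forall i, i <= t' -> q i \in X &
    forall i j, i <= j -> j <= t' -> cadj (q i) (q j) = (j <= i.+1)].
Proof.
elim/ltn_ind: t p => t IH p p0 pt pX padj.
have [/existsP[i /existsP[j /andP[ij cij]]]|noshort] :=
  boolP [exists i : 'I_t.+1, exists j : 'I_t.+1,
           (i.+1 < j) && cadj (p i) (p j)]; last first.
  exists t, p; split=> // i j ij jt.
  case: (leqP j i.+1) => ji; last first.
    apply: contraNF noshort => cij; apply/existsP.
    exists (inord i); apply/existsP; exists (inord j).
    by rewrite !inordK ?ji //; lia.
  have [<-|ne_ij] := eqVneq i j; first by rewrite cadj_refl.
  have -> : j = i.+1 by lia.
  by apply: adj_cadj; apply: padj; lia.
have jt : j <= t by rewrite -ltnS.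
have [eq_ij|ne_ij] := eqVneq (p i) (p j).
  apply: (IH (t - (j - i)) _
            (fun k => if k <= i then p k else p (k + (j - i)))).
  - by lia.
  - by [].
  - case: leqP => h; last by rewrite -pt; congr p; lia.
    have -> : t - (j - i) = i by lia.
    by rewrite eq_ij -pt; congr p; lia.
  - by move=> k kt; case: leqP => h; apply: pX; lia.
  - move=> k kt; case: (leqP k i) => h; case: (leqP k.+1 i) => h'; try lia.
    + by apply: padj; lia.
    + have -> : k = i by lia.
      have -> : i.+1 + (j - i) = j.+1 by lia.
      by rewrite eq_ij; apply: padj; lia.
    + by apply: padj; lia.
have aij : adj (p i) (p j) by rewrite adjE ne_ij.
apply: (IH (t - (j - i).-1) _
          (fun k => if k <= i then p k else p (k + (j - i).-1))).
- by lia.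
- by [].
- by case: leqP => h; [lia|rewrite -pt; congr p; lia].
- by move=> k kt; case: leqP => h; apply: pX; lia.
- move=> k kt; case: (leqP k i) => h; case: (leqP k.+1 i) => h'; try lia.
  + by apply: padj; lia.
  + have -> : k = i by lia.
    by have -> : i.+1 + (j - i).-1 = j by lia.
  + by apply: padj; lia.
Qed.

Definition simplicial U u : Prop :=
  forall x y, x \in U -> y \in U -> adj u x -> adj u y -> cadj x y.

Hypothesis no_hole : forall N f, 4 <= N -> ~ @hole G N f.

(* An induced path from x to y through W, closed up by v, would be a hole. *)
Lemma attachment_cadj v (W : {set G}) x y :
  (forall w, w \in W -> ~~ cadj v w) -> adj v x -> adj v y ->
  forall c d, c \in W -> d \in W -> adj x c -> adj y d ->
  connect (fun a b => [&& adj a b, a \in W & b \in W]) c d -> cadj x y.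
Proof.
move=> Wv vx vy c d cW dW xc yd /connectP[s sP sd].
apply/negPn/negP => nxy; set X := x |: (y |: W).
(* The default [y] of [nth] serves as the last vertex of the walk, at index [(size s).+2]. *)
pose p i := nth y (x :: c :: s) i.
have sW : all [in W] s.
  elim: s c cW sP {sd p xc} => //= a s IH c cW /andP[/and3P[_ _ aW] sP].
  by rewrite aW (IH a).
have [t [q [q0 qt qX qadj]]] : exists t q, [/\ q 0 = x, q t = y,
    forall i, i <= t -> q i \in X &
    forall i j, i <= j -> j <= t -> cadj (q i) (q j) = (j <= i.+1)].
  apply: (@induced_path X x y (size s).+2 p) => //.
  - by rewrite /p nth_default.
  - move=> i it; have : p i \in y :: x :: c :: s.
      rewrite /p; case: (ltnP i (size s).+2) => h.
        by rewrite inE mem_nth ?orbT.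
      by rewrite nth_default // inE eqxx.
    rewrite !inE => /or4P[/eqP->|/eqP->|/eqP->|/(allP sW) h].
    + by rewrite eqxx orbT.
    + by rewrite eqxx.
    + by rewrite cW !orbT.
    + by rewrite [_ \in W]h !orbT.
  - move=> i it; case: i it => [|i] it; first by [].
    rewrite /p /=; case: (ltnP i (size s)) => h.
      by move/(pathP y)/(_ i h): sP => /and3P[].
    have -> : i = size s by lia.
    by rewrite [nth y s _]nth_default // nth_last /= -sd adj_sym.
have t2 : 2 <= t.
  rewrite ltnNge; apply: contra nxy => t1.
  by rewrite -q0 -qt qadj //.
(* An interior vertex equal to [x] or [y] would have the closed adjacencies of an end of the path,
   contradicting inducedness. *)
have inW i : 0 < i < t -> q i \in W.
  case/andP=> i0 it; have := qX i (ltnW it); rewrite !inE.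
  case/or3P=> [| |//] /eqP qi.
    have : cadj (q 0) (q i.+1) = cadj (q i) (q i.+1) by rewrite q0 qi.
    by rewrite !qadj // !ltnS leqn0 leqnn eqn0Ngt i0.
  case: i i0 it qi => // i _ it qi.
  have : cadj (q i) (q t) = cadj (q i) (q i.+1) by rewrite qt qi.
  rewrite (qadj _ _ (ltnW (ltnW it)) (leqnn t)) (qadj _ _ (leqnSn i) (ltnW it)).
  by rewrite leqNgt it leqnn.
pose g i := if i is i'.+1 then q i' else v.
apply: (@no_hole t.+2 g); first by [].
have vq j : j <= t -> cadj v (q j) = (j == 0) || (j == t).
  move=> jt; have [->|j0] := eqVneq j 0; first by rewrite q0 adj_cadj.
  have [->|jt'] := eqVneq j t; first by rewrite qt adj_cadj.
  by apply/negbTE/Wv/inW; lia.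
move=> [|i] [|j] iN jN /=.
- by rewrite cadj_refl.
- by rewrite vq // /cyc; lia.
- by rewrite cadjC vq // /cyc; lia.
- case: (leqP i j) => ij; first by rewrite qadj // /cyc; lia.
  by rewrite cadjC qadj ?(ltnW ij) // /cyc; lia.
Qed.

(** Dirac's argument, by induction on the size of [U]. Let [C] be the component of [w] among the
    non-neighbours of [v], and [S] the neighbours of [v] attached to [C]; [S] is a clique since
    there are no holes. The set [C :|: S] omits [v], so induction applies to it; keeping the
    simplicial vertex away from a suitable vertex forces it into [C]. *)
Lemma simplicial_away U v w :
  v \in U -> w \in U -> ~~ cadj v w ->
  exists u, [/\ u \in U, ~~ cadj v u & simplicial U u].
Proof.
have [n] := ubnP #|U|; elim: n U v w => // n IH U v w Un vU wU vw.
pose W := [set x in U | ~~ cadj v x].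
pose e := [rel a b | [&& adj a b, a \in W & b \in W]].
have e_sym : connect_sym e.
  by apply: sym_connect_sym => a b /=; rewrite adj_sym [(b \in W) && _]andbC.
have wW : w \in W by rewrite inE wU.
pose C := [set x | connect e w x].
have CW x : x \in C -> x \in W.
  rewrite inE => /connectP[s sP ->].
  elim: s w wW sP {vw wU C} => //= a s IHs z _.
  by case/andP=> /and3P[_ _ aW]; apply: IHs.
pose S := [set x in U | adj v x && [exists c in C, adj x c]].
have Sclique x y : x \in S -> y \in S -> cadj x y.
  rewrite !inE => /and3P[_ vx /existsP[c /andP[cC xc]]].
  case/and3P=> _ vy /existsP[d /andP[dC yd]].
  apply: (@attachment_cadj v W x y _ vx vy c d) => //; try exact: CW.
    by move=> z; rewrite inE => /andP[].
  move: cC dC; rewrite !inE => wc; apply: connect_trans.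
  by rewrite e_sym in wc.
have sub : C :|: S \subset U.
  by apply/subsetP => x /setUP[/CW|]; rewrite inE => /andP[].
have lt_card : #|C :|: S| < n.
  rewrite -ltnS; apply: leq_trans Un; rewrite ltnS; apply: proper_card.
  rewrite properE sub; apply/subsetPn; exists v => //.
  apply/negP => /setUP[/CW|]; rewrite inE ?cadj_refl ?andbF //.
  by rewrite adj_irr andbF.
(* All neighbours in [U] of a vertex of [C] lie in [C :|: S]. *)
have lift u : u \in C -> simplicial (C :|: S) u ->
    exists u, [/\ u \in U, ~~ cadj v u & simplicial U u].
  move=> uC simp_u; have := CW u uC; rewrite inE => /andP[uU vu].
  exists u; split=> //.
  have nbr z : z \in U -> adj u z -> z \in C :|: S.
    move=> zU uz; apply/setUP; have [vz|vz] := boolP (cadj v z).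
      right; rewrite inE zU /=; apply/andP; split.
        rewrite adjE vz andbT; apply: contraNneq vu => ->.
        by rewrite cadjC adj_cadj.
      by apply/existsP; exists u; rewrite uC adj_sym.
    left; move: (uC); rewrite !inE => wu; apply: connect_trans wu _.
    by apply: connect1; rewrite /= uz CW //= inE zU.
  by move=> x y xU yU ux uy; apply: simp_u => //; apply: nbr.
have [/existsP[s /existsP[z /and3P[sS zU sz]]]|Suniv] :=
  boolP [exists s, exists z, [&& s \in S, z \in C :|: S & ~~ cadj s z]].
  have [|u [uU su simp_u]] := IH _ s z lt_card _ zU sz.
    by rewrite inE sS orbT.
  apply: (lift u) => //; case/setUP: uU => // uS.
  by rewrite Sclique in su.
have [/existsP[c /existsP[z /and3P[cC zU cz]]]|Cuniv] :=
  boolP [exists c, exists z, [&& c \in C, z \in C :|: S & ~~ cadj c z]].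
  have [|u [uU cu simp_u]] := IH _ c z lt_card _ zU cz.
    by rewrite inE cC.
  apply: (lift u) => //; case/setUP: uU => // uS; case/existsP: Suniv.
  by exists u; apply/existsP; exists c; rewrite uS inE cC cadjC.
apply: (lift w); first by rewrite inE connect0.
move=> x y xU yU _ _; apply/negPn/negP => xy.
case/setUP: xU => [xC|xS].
  by case/existsP: Cuniv; exists x; apply/existsP; exists y; rewrite xC yU.
by case/existsP: Suniv; exists x; apply/existsP; exists y; rewrite xS yU.
Qed.

Lemma simplicial_exists U :
  U != set0 -> exists2 u, u \in U & simplicial U u.
Proof.
case/set0Pn=> v vU.
have [/existsP[a /existsP[b /and3P[aU bU ab]]]|nU] :=
  boolP [exists a, exists b, [&& a \in U, b \in U & ~~ cadj a b]].
  by have [u [uU _ simp_u]] := simplicial_away aU bU ab; exists u.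
exists v => // x y xU yU _ _; apply/negPn/negP => xy; case/existsP: nU.
by exists x; apply/existsP; exists y; rewrite xU yU.
Qed.

(** Greedy colouring along a perfect elimination order: a simplicial vertex and its neighbours form
    a clique, so its neighbours use fewer than [c] colours. *)
Lemma chordal_colorable c :
  (forall A : {set G}, clique A -> #|A| <= c) -> colorable G c.
Proof.
move=> clique_c.
suff [col colP] : exists col : G -> nat,
    forall x, x \in [set: G] -> col x < c /\
      forall y, y \in [set: G] -> adj x y -> col x != col y.
  apply: (@colorable_of_nat _ _ col) => [x|x y xy].
    by have [] := colP x (in_setT x).
  by have [_] := colP x (in_setT x); apply.
move: [set: G] => U; have [n] := ubnP #|U|; elim: n U => // n IH U Un.
have [->|/simplicial_exists[u uU simp_u]] := eqVneq U set0.
  by exists (fun=> 0) => x; rewrite inE.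
have [|col colP] := IH (U :\ u).
  by rewrite (cardsD1 u U) uU in Un.
pose K := [set x in U | adj u x].
have Kc : #|K| < c.
  have uK : u \notin K by rewrite inE adj_irr andbF.
  have := clique_c (u |: K); rewrite cardsU1 uK; apply.
  move=> x y; rewrite !inE.
  case/orP=> [/eqP->|/andP[xU ux]]; case/orP=> [/eqP->|/andP[yU uy]].
  - exact: cadj_refl.
  - exact: adj_cadj.
  - by rewrite cadjC adj_cadj.
  - exact: simp_u.
have [a ac aK] : exists2 a, a < c & a \notin [seq col x | x in K].
  have [/allP sub|/allPn[a]] :=
    boolP (all [in [seq col x | x in K]] (iota 0 c)).
    have := uniq_leq_size (iota_uniq 0 c) sub.
    by rewrite size_iota size_image leqNgt Kc.
  by rewrite mem_iota => ac aK; exists a.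
have newP x : x \in U -> adj u x -> a != col x.
  by move=> xU ux; apply: contraNneq aK => ->; apply: image_f; rewrite inE xU.
exists (fun x => if x == u then a else col x) => x xU.
have [->|xu] := eqVneq x u.
  split=> // y yU uy; have [yu|yu] := eqVneq y u; last exact: newP.
  by rewrite yu adj_irr in uy.
have [|cx xP] := colP x; first by rewrite !inE xu.
split=> // y yU xy; have [yu|yu] := eqVneq y u.
  by rewrite eq_sym newP // adj_sym -yu.
by apply: xP => //; rewrite !inE yu.
Qed.

End Chordal.

(** * Graphs with a hole of length 2 alpha + 1 *)

(** Rotation by [a] modulo N, for [a <= N] and [i < N]. *)
Definition shift (N a i : nat) : nat := if i + a < N then i + a else i + a - N.

Lemma shift_lt N a i : a <= N -> i < N -> shift N a i < N.
Proof. by move=> aN iN; rewrite /shift; case: ifP => h; lia. Qed.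

Lemma shiftK N a i : a <= N -> i < N -> shift N a (shift N (N - a) i) = i.
Proof.
by rewrite /shift; case: (ltnP (i + (N - a)) N) => ?; case: ifP => ?; lia.
Qed.

Lemma shiftVK N a i : a <= N -> i < N -> shift N (N - a) (shift N a i) = i.
Proof. by rewrite /shift; case: (ltnP (i + a) N) => ?; case: ifP => ?; lia. Qed.

Lemma cyc_shift N a i j :
  a <= N -> i < N -> j < N -> cyc N (shift N a i) (shift N a j) = cyc N i j.
Proof. by rewrite /shift /cyc; do 2!case: ifP => ?; lia. Qed.

Section Blowup.

Variable G : sgraph.
Implicit Types (x y z u v w : G) (f : nat -> G).

Let N := (alpha G).*2.+1.

Hypothesis alpha2 : 2 <= alpha G.
Hypothesis no_hole : forall l f, 4 <= l -> l < N -> ~ @hole G l f.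

Lemma hole_shift f a : a <= N -> hole N f -> hole N (fun i => f (shift N a i)).
Proof.
by move=> aN hf i j iN jN; rewrite hf ?shift_lt // cyc_shift.
Qed.

(** Seen from the hole, [v] is a closed twin of [f i]. *)
Definition centered f v i : Prop :=
  i < N /\ forall j, j < N -> cadj v (f j) = cyc N i j.

Lemma centered_shift f v a : a <= N ->
  (exists i, centered (fun j => f (shift N a j)) v i) ->
  exists i, centered f v i.
Proof.
move=> aN [i [iN iP]]; exists (shift N a i); split; first exact: shift_lt.
move=> j jN; have jN' : shift N (N - a) j < N.
  by rewrite /shift; case: ifP => ?; lia.
by rewrite -{1}(shiftK aN jN) iP // -(cyc_shift aN) // shiftK.
Qed.

Lemma centered_gap f v :
  hole N f -> cadj v (f 0) -> ~~ cadj v (f 1) -> exists i, centered f v i.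
Proof.
move=> hf v0 v1; have N5 : 5 <= N by rewrite /N; lia.
(* The sentinel [N] covers the case of no further neighbour. *)
have ext : exists t, (1 < t) && ((t == N) || cadj v (f t)).
  by exists N; rewrite eqxx; lia.
have [t /andP[t1 tP] t_min] := ex_minnP ext.
have tN : t <= N by apply: t_min; rewrite eqxx; lia.
have gap j : 0 < j < t -> cadj v (f j) = false.
  move=> jt; have [->|j1] := eqVneq j 1; first exact/negbTE.
  apply: contraTF jt => vj; have := t_min j; rewrite vj orbT; lia.
have [t_big|t_small] := leqP N.-1 t.
  suff : (alpha G).+1 <= alpha G by rewrite ltnn.
  apply: (@alpha_geq _ _ (fun i => if i is i'.+1 then f i'.*2.+1 else v)).
  move=> [|i] [|j] //= ij jN.
    by rewrite gap //; move: t_big; rewrite /N; lia.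
  by rewrite hf; move: jN; rewrite /N /cyc; lia.
have vt : cadj v (f t) by case/orP: tP => // /eqP tN'; lia.
have t_eq : t.+2 = N.
  apply/eqP; rewrite eqn_leq; apply/andP; split; first by lia.
  rewrite leqNgt; apply/negP => tN'.
  apply: (@no_hole t.+2 (fun i => if i is i'.+1 then f i' else v)) => //.
  have vf j : j <= t -> cadj v (f j) = (j == 0) || (j == t).
    move=> jt; have [->|j0] := eqVneq j 0; first by rewrite v0.
    by have [->|jt'] := eqVneq j t; [rewrite vt|rewrite gap //; lia].
  move=> [|i] [|j] iN jN /=.
  - by rewrite cadj_refl.
  - by rewrite vf // /cyc; lia.
  - by rewrite cadjC vf // /cyc; lia.
  - by rewrite hf /cyc; lia.
(* Otherwise [v] and the hole vertices at N - 2, N - 1 and 0 form a hole of length 4. *)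
have vN : cadj v (f N.-1).
  apply/negPn/negP => nvN.
  apply: (@no_hole 4 (fun i => nth v [:: v; f N.-2; f N.-1; f 0] i)) => //.
  have -> : N.-2 = t by lia.
  case=> [|[|[|[|i]]]] // [|[|[|[|j]]]] // _ _ /=; rewrite ?cadj_refl //.
  all: rewrite ?hf ?v0 ?vt ?(cadjC _ v) ?v0 ?vt ?(negbTE nvN) /cyc //; try lia.
exists N.-1; split; first by lia.
move=> j jN; have [->|j0] := eqVneq j 0; first by rewrite v0 /cyc; lia.
have [->|jt] := eqVneq j t; first by rewrite vt /cyc; lia.
have [->|jN'] := eqVneq j N.-1; first by rewrite vN /cyc; lia.
by rewrite gap /cyc; lia.
Qed.

(** A vertex seeing nothing of the hole would extend an independent set of alpha hole vertices. A
    vertex seeing part of it has a neighbour directly followed by a non-neighbour; two rotations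
    bring these to positions 0 and 1. *)
Lemma hole_nbhd f v : hole N f ->
  (exists i, centered f v i) \/ (forall j, j < N -> cadj v (f j)).
Proof.
move=> hf.
have [/existsP[y ny]|ally] := boolP [exists j : 'I_N, ~~ cadj v (f j)];
  last first.
  right=> j jN; apply/negPn/negP => vj; case/existsP: ally.
  by exists (Ordinal jN).
left.
have [/existsP[x vx]|nox] := boolP [exists j : 'I_N, cadj v (f j)];
  last first.
  suff : (alpha G).+1 <= alpha G by rewrite ltnn.
  have no j : j < N -> ~~ cadj v (f j).
    by move=> jN; apply: contra nox => vj; apply/existsP; exists (Ordinal jN).
  apply: (@alpha_geq _ _ (fun i => if i is i'.+1 then f i'.*2.+1 else v)).
  move=> [|i] [|j] //= ij jN; first by rewrite no // /N; lia.
  by rewrite hf; move: jN; rewrite /N /cyc; lia.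
apply: (centered_shift (ltnW (ltn_ord x))); set g := fun j => f _.
have hg : hole N g by apply: hole_shift => //; apply: ltnW.
have g0 : cadj v (g 0).
  by rewrite /g /shift add0n ltn_ord.
have ex : exists j, (j < N) && ~~ cadj v (g j).
  exists (shift N (N - x) y).
  rewrite /g shiftK ?ltn_ord // ?(ltnW (ltn_ord x)) // ny andbT.
  by have := ltn_ord x; have := ltn_ord y; rewrite /shift; case: ifP => ?; lia.
have [j /andP[jN vj] j_min] := ex_minnP ex.
have j0 : 0 < j by rewrite lt0n; apply: contraNneq vj => ->.
have jN' : j.-1 < N by lia.
apply: (centered_shift (ltnW jN')); apply: centered_gap.
- exact: hole_shift (ltnW jN') hg.
- rewrite /shift add0n jN'; apply/negPn/negP => vj'.
  by have := j_min j.-1; rewrite vj' jN'; lia.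
- by rewrite /shift add1n prednK // jN.
Qed.

(** As N is at least 5, the positions two and three steps after [i'] are both non-neighbours of it,
    and only one of them can be [i]. *)
Lemma cyc_not_all i i' :
  i' < N -> ~ (forall j, j < N -> j != i -> cyc N i' j).
Proof.
move=> iN all_j; have N5 : 5 <= N by rewrite /N; lia.
move: (all_j (shift N 2 i')) (all_j (shift N 3 i')).
by rewrite /shift /cyc; do 2!case: ifP => ?; lia.
Qed.

(** Agreement off [i] first forces [i'] and [j] to be equal or consecutive; the closed
    neighbourhoods of consecutive positions a and a + 1 differ at both a - 1 and a + 2. *)
Lemma cyc_eq_but_one i j i' : i' < N -> j < N ->
  (forall l, l < N -> l != i -> cyc N i' l = cyc N j l) -> i' = j.
Proof.
have N5 : 5 <= N by rewrite /N; lia.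
move=> iN jN E; apply/eqP/negPn/negP => ne_ij.
have near : cyc N i' j.
  have [ij|ij] := eqVneq j i; last by rewrite E // /cyc eqxx.
  by rewrite cycC -E -?ij // /cyc eqxx.
have far a b : a < N -> b = shift N 1 a ->
    (forall l, l < N -> l != i -> cyc N a l = cyc N b l) -> False.
  rewrite /shift => aN b_eq Eab.
  have diff l : l < N -> cyc N a l != cyc N b l -> l = i.
    by move=> lN; apply: contraNeq => li; rewrite Eab.
  have [a0|a0] := posnP a.
    have h1 : 2 = i by apply: diff; rewrite ?b_eq /cyc ?a0; [|case: ifP]; lia.
    have h2 : N.-1 = i by apply: diff; rewrite ?b_eq /cyc ?a0; [|case: ifP]; lia.
    by lia.
  have h1 : a.-1 = i by apply: diff; rewrite ?b_eq /cyc; [|case: ifP]; lia.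
  have [a2|a2] := ltnP a.+2 N.
    have h2 : a.+2 = i by apply: diff; rewrite ?b_eq /cyc; [|case: ifP]; lia.
    by lia.
  have [a1|a1] := ltnP a.+1 N.
    have h2 : 0 = i by apply: diff; rewrite ?b_eq /cyc; [|case: ifP]; lia.
    by lia.
  have h2 : 1 = i by apply: diff; rewrite ?b_eq /cyc; [|case: ifP]; lia.
  by lia.
have [ij|ji] : j = shift N 1 i' \/ i' = shift N 1 j.
  by move: near; rewrite /cyc /shift; do 2!case: ifP => ?; lia.
- exact: (far i' j).
- by apply: (far j i') => // l lN li; rewrite E.
Qed.

Lemma hole_replace f v i : hole N f -> centered f v i ->
  hole N (fun j => if j == i then v else f j).
Proof.
move=> hf [iN vP] j l jN lN.
have [->|ji] := eqVneq j i; have [->|li] := eqVneq l i.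
- by rewrite cadj_refl /cyc eqxx.
- exact: vP.
- by rewrite cadjC cycC vP.
- exact: hf.
Qed.

Lemma centered_adj_dominating f v w i : hole N f -> centered f v i ->
  (forall j, j < N -> cadj w (f j)) -> cadj v w.
Proof.
move=> hf vi wP.
have [[j [jN jP]]|wP'] := hole_nbhd w (hole_replace hf vi).
  exfalso; apply: (@cyc_not_all i j) => // l lN li.
  by rewrite -jP // (negbTE li) wP.
by have := wP' i (proj1 vi); rewrite eqxx cadjC.
Qed.

(** Put [v] in place of [f i] and classify [w] against the new hole: the other N - 1 positions
    already determine its type, and position [i] then gives its adjacency to [v]. *)
Lemma centered_adj f v w i j : hole N f -> centered f v i -> centered f w j ->
  cadj v w = cyc N i j.
Proof.
move=> hf vi [jN wP].
have [[i' [iN' iP]]|wP'] := hole_nbhd w (hole_replace hf vi).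
  have eq_ij : i' = j.
    apply: (@cyc_eq_but_one i) => // l lN li.
    by rewrite -iP // (negbTE li) wP.
  by have := iP i (proj1 vi); rewrite eqxx eq_ij cadjC cycC.
exfalso; apply: (@cyc_not_all i j) => // l lN li.
by have := wP' l lN; rewrite (negbTE li) wP.
Qed.

(** Otherwise [v], [f 0], [w], [f 2] would form a hole of length 4. *)
Lemma dominating_adj f v w : hole N f ->
  (forall j, j < N -> cadj v (f j)) -> (forall j, j < N -> cadj w (f j)) ->
  cadj v w.
Proof.
move=> hf vP wP; have N5 : 5 <= N by rewrite /N; lia.
apply/negPn/negP => nvw.
apply: (@no_hole 4 (fun i => nth v [:: v; f 0; w; f 2] i)) => //.
have f02 : cadj (f 0) (f 2) = false by rewrite hf /cyc; lia.
have [v0 v2] : cadj v (f 0) /\ cadj v (f 2) by split; apply: vP; lia.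
have [w0 w2] : cadj w (f 0) /\ cadj w (f 2) by split; apply: wP; lia.
case=> [|[|[|[|i]]]] // [|[|[|[|j]]]] // _ _ /=; rewrite ?cadj_refl //.
all: by rewrite ?v0 ?v2 ?w0 ?w2 ?f02 ?(negbTE nvw) // cadjC
                ?v0 ?v2 ?w0 ?w2 ?f02 ?(negbTE nvw).
Qed.

(* Layer N collects the vertices adjacent to the whole hole. *)
Lemma blowup_of_hole f : hole N f ->
  exists h : G -> nat, (forall v, h v <= N) /\
    forall v w, cadj v w = [|| h v == N, h w == N | cyc N (h v) (h w)].
Proof.
move=> hf.
pose h v := if [pick i : 'I_N | [forall j : 'I_N, cadj v (f j) == cyc N i j]]
            is Some i then i : nat else N.
have hP v : centered f v (h v) \/
            (h v = N /\ forall j, j < N -> cadj v (f j)).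
  rewrite /h; case: pickP => [i /forallP iP|noi].
    by left; split=> // j jN; apply/eqP/(iP (Ordinal jN)).
  right; split=> //; have [[i [iN iP]]|//] := hole_nbhd v hf.
  by have /forallP[] := noi (Ordinal iN) => j; rewrite iP.
exists h; split=> [v|v w]; first by have [[]|[]] := hP v; lia.
have [vP|[vN vP]] := hP v; have [wP|[wN wP]] := hP w.
- by rewrite (centered_adj hf vP wP) (ltn_eqF (proj1 vP)) (ltn_eqF (proj1 wP)).
- by rewrite (centered_adj_dominating hf vP wP) wN eqxx orbT.
- by rewrite cadjC (centered_adj_dominating hf wP vP) vN eqxx.
- by rewrite (dominating_adj hf vP wP) vN eqxx.
Qed.

End Blowup.

(** * Colouring a blow-up *)

Section Layers.

Variables (G : sgraph) (k : nat) (h : G -> nat).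
Implicit Types (x y z u v w : G).

Let N := k.*2.+1.

Hypothesis k2 : 2 <= k.
Hypothesis hN : forall v, h v <= N.
Hypothesis hP :
  forall v w, cadj v w = [|| h v == N, h w == N | cyc N (h v) (h w)].

Definition layer (i : nat) : {set G} := [set v | h v == i].
Definition rk v : nat := index v (enum (layer (h v))).

Lemma rk_lt v : rk v < #|layer (h v)|.
Proof. by rewrite cardE index_mem mem_enum inE. Qed.

Lemma rk_inj v w : h v = h w -> rk v = rk w -> v = w.
Proof.
rewrite /rk => hvw; rewrite hvw => /(f_equal (nth v (enum (layer (h w))))).
by rewrite !nth_index // mem_enum inE ?hvw.
Qed.

Lemma layer_nth x0 i r : r < #|layer i| ->
  h (nth x0 (enum (layer i)) r) = i /\ rk (nth x0 (enum (layer i)) r) = r.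
Proof.
move=> ri; rewrite cardE in ri.
have /eqP hi : h (nth x0 (enum (layer i)) r) == i.
  by have := mem_nth x0 ri; rewrite mem_enum inE.
by rewrite /rk hi index_uniq ?enum_uniq.
Qed.

Lemma card_layers i j l (L := layer i :|: layer j :|: layer l) :
  uniq [:: i; j; l] -> #|L| = #|layer i| + #|layer j| + #|layer l|.
Proof.
rewrite /= !inE negb_or => /andP[/andP[ij il] /andP[jl _]].
rewrite !cardsU.
have -> : layer i :&: layer j = set0.
  by apply/setP => v; rewrite !inE; apply: contraNF ij => /andP[/eqP<-].
have -> : (layer i :|: layer j) :&: layer l = set0.
  apply/setP => v; rewrite !inE; apply/negP => /andP[/orP[]/eqP hv /eqP hv'].
    by rewrite -hv hv' eqxx in il.
  by rewrite -hv hv' eqxx in jl.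
by rewrite !cards0 !subn0.
Qed.

Lemma layers_clique i j : cyc N i j ->
  clique (layer i :|: layer j :|: layer N).
Proof.
move=> ij x y; rewrite !inE hP.
by move=> /orP[/orP[]|] /eqP-> => /orP[/orP[]|] /eqP->;
   rewrite ?eqxx ?orbT // ?ij ?[cyc N j i]cycC ?ij /cyc ?eqxx ?orbT.
Qed.

(** Allows a smallest layer to be renumbered as layer 0, with the dominating layer [N] kept
    fixed. *)
Lemma rotate_layers a : a <= N ->
  let h' v := if h v == N then N else shift N a (h v) in
  (forall v, h' v <= N) /\
  (forall v w, cadj v w = [|| h' v == N, h' w == N | cyc N (h' v) (h' w)]).
Proof.
move=> aN h'.
have h'E v : (h v == N) = (h' v == N).
  rewrite /h'; case: eqVneq => hv; first by rewrite eqxx.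
  by rewrite ltn_eqF // shift_lt // ltn_neqAle hv hN.
split=> [v|v w].
  rewrite /h'; case: eqVneq => // hv.
  by rewrite ltnW // shift_lt // ltn_neqAle hv hN.
rewrite hP -!h'E /h'; case: eqVneq => //= hv; case: eqVneq => //= hw.
by rewrite cyc_shift // ltn_neqAle ?hv ?hw hN.
Qed.

Section Coloring.

Variables c l : nat.
Hypothesis clique_c : forall A : {set G}, clique A -> #|A| <= c.
Hypothesis lk : 0 < l <= k.
Hypothesis four_c :
  #|layer N| + #|layer 0| + #|layer 1| + #|layer l.*2| <= c.

(** Colours from [c'] on are reserved for layer [N]; the other layers share those below. *)
Let c' := c - #|layer N|.
Let n0 := #|layer 0|.
Let n1 := #|layer 1|.

Let swap p := if p < n0 then n1 + p else if p < n0 + n1 then p - n0 else p.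

Let swap_inj p q : swap p = swap q -> p = q.
Proof. by rewrite /swap; do !case: ifP => ?; lia. Qed.

Let swap_id p : n0 + n1 <= p -> swap p = p.
Proof. by rewrite /swap; do !case: ifP => ?; lia. Qed.

Let pair_c i j : i < N -> j < N -> i != j -> cyc N i j ->
  #|layer i| + #|layer j| <= c'.
Proof.
move=> iN jN ij cij; have := clique_c (layers_clique cij).
rewrite card_layers; first by rewrite /c'; lia.
by rewrite /= !inE negb_or ij !ltn_eqF.
Qed.

Let layer_c i : i < N -> #|layer i| <= c'.
Proof.
move=> iN; have [i1|i1] := ltnP i.+1 N.
  by have := @pair_c i i.+1; rewrite /cyc; lia.
by have := @pair_c i 0; rewrite /cyc; lia.
Qed.

Let pos v := if odd (h v) || (h v == 0) then rk v else c' - (rk v).+1.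

(* Odd layers take the lowest colours and even layers the highest ones, but
   layer 0 must avoid both layer 1 and layer 2k; so the blocks of colours used
   by layers 0 and 1 are exchanged from layer 2l on, which does not affect the
   colours of layer 2l itself. *)
Let col v :=
  if h v == N then c' + rk v
  else if 0 < h v <= l.*2 then pos v else swap (pos v).

Let pos_lt v : h v < N -> pos v < c'.
Proof.
move=> vN; have := layer_c vN; have := rk_lt v; rewrite /pos.
by case: ifP => _; lia.
Qed.

Let col_lt v : h v < N -> col v < c'.
Proof.
move=> vN; have := pos_lt vN; rewrite /col ltn_eqF //; case: ifP => // _.
have := @pair_c 0 1; rewrite /swap -/n0 -/n1 /cyc /N.
by do !case: ifP => ?; lia.
Qed.

(** Apart from the pair 0, 1, two neighbouring layers get one low and one high block of positions,
    which together fit into [c']. *)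
Let pos_neq v w : h v < h w -> h w < N -> cyc N (h v) (h w) -> 1 < h w ->
  pos v <> pos w.
Proof.
move=> vw wN cvw w1; have := @pair_c (h v) (h w) ltac:(lia) wN ltac:(lia) cvw.
have := rk_lt v; have := rk_lt w; rewrite /pos.
have -> : (odd (h w) || (h w == 0)) = ~~ (odd (h v) || (h v == 0)).
  by move: cvw; rewrite /cyc /N; lia.
by case: ifP => _ /=; lia.
Qed.

Let col_neq v w : h v <= h w -> v != w -> cadj v w -> col v != col w.
Proof.
move=> vw ne_vw avw; apply/eqP => eq_col.
have [wN|wN] := eqVneq (h w) N.
  have [vN|vN] := eqVneq (h v) N.
    move: eq_col; rewrite /col vN wN eqxx => eq_rk.
    by case/eqP: ne_vw; apply: rk_inj; [rewrite vN|lia].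
  have := @col_lt v; rewrite eq_col {1}/col wN eqxx.
  by have := hN v; lia.
have wN' : h w < N by have := hN w; lia.
have vN : h v < N by lia.
have cvw : cyc N (h v) (h w) by move: avw; rewrite hP !ltn_eqF.
move: (vw); rewrite leq_eqVlt => /orP[/eqP eq_h|lt_h].
  have eq_pos : pos v = pos w.
    move: eq_col; rewrite /col eq_h (ltn_eqF wN').
    by case: ifP => // _ /swap_inj.
  case/eqP: ne_vw; apply: rk_inj => //; move: eq_pos; rewrite /pos eq_h.
  case: ifP => // _; have := rk_lt v; have := rk_lt w; have := layer_c wN'.
  by rewrite eq_h; lia.
(* Layers 0 and 1 both have low positions; the exchange moves layer 0 just above the [n1] colours of
   layer 1. *)
have [w1|w1] := leqP (h w) 1.
  have [hv hw] : h v = 0 /\ h w = 1 by lia.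
  move: eq_col; have := rk_lt v; have := rk_lt w.
  rewrite /col (ltn_eqF wN') (ltn_eqF vN) /pos hv hw /= /swap -/n0 -/n1.
  have -> : 0 < l.*2 by lia.
  by case: ifP => ?; lia.
have := pos_neq lt_h wN' cvw w1; apply.
(* By [four_c], layer 2l lies above both exchanged blocks, so it may be counted on either side of
   the exchange. *)
have fix2l u : h u = l.*2 -> swap (pos u) = pos u.
  move=> hu; apply: swap_id; rewrite /pos hu odd_double /=.
  by have := rk_lt u; rewrite hu /n0 /n1 /c'; case: ifP; lia.
move: eq_col; rewrite /col !ltn_eqF //.
case: ifP => hv; case: ifP => hw //; last by move/swap_inj.
  move=> eq_vw; apply: swap_inj; rewrite (fix2l v) //.
  by move: cvw; rewrite /cyc; lia.
move=> eq_vw; apply: swap_inj; rewrite (fix2l w) //.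
by move: cvw lk; rewrite /cyc /N; lia.
Qed.

Lemma blowup_colorable : colorable G c.
Proof.
apply: (@colorable_of_nat _ _ col) => [v|v w].
  have [vN|vN] := eqVneq (h v) N.
    by rewrite /col vN eqxx; have := rk_lt v; rewrite vN /c'; lia.
  have := @col_lt v; have := hN v; rewrite /c'; lia.
rewrite adjE => /andP[ne_vw avw]; have [vw|/ltnW vw] := leqP (h v) (h w).
  exact: col_neq.
by rewrite eq_sym; apply: col_neq; rewrite 1?eq_sym 1?cadjC.
Qed.

End Coloring.

End Layers.

(** * Immersions *)

Section Paths.

Variable G : sgraph.
Implicit Types (x y : G) (p : nat -> G).

Lemma mkseq_path p n :
  (forall i, i < n -> adj (p i) (p i.+1)) ->
  (forall i j, i <= n -> j <= n -> p i = p j -> i = j) ->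
  is_path (mkseq p n.+1).
Proof.
move=> padj pinj; apply/and3P; split=> //.
  apply/(sortedP (p 0)) => i; rewrite size_mkseq => iN.
  by rewrite !nth_mkseq ?(ltnW iN) //; apply: padj.
rewrite map_inj_in_uniq ?iota_uniq // => i j; rewrite !mem_iota => iN jN.
by apply: pinj; lia.
Qed.

Lemma mkseq_ends p n : path_ends (mkseq p n.+1) = [set p 0; p n].
Proof.
rewrite /path_ends /mkseq /= last_map (last_nth 0) size_iota.
by rewrite -[0 :: _]/(iota 0 n.+1) nth_iota.
Qed.

Lemma mkseq_interior p n x : x \in path_interior (mkseq p n.+1) ->
  exists2 i, 0 < i < n & x = p i.
Proof.
have -> : path_interior (mkseq p n.+1) = [seq p i | i <- iota 1 n.-1].
  rewrite /path_interior /mkseq /=; case: n => //= n.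
  rewrite belast_map; congr map.
  have belast_iota m : belast m (iota m.+1 n) = iota m n.
    by elim: n m => //= n IH m; rewrite IH.
  exact: belast_iota.
case/mapP=> i; rewrite mem_iota => iN ->; exists i => //; lia.
Qed.

Lemma mkseq_edges p n (d : {set G}) : d \in path_edges (mkseq p n.+1) ->
  exists2 i, i < n & d = [set p i; p i.+1].
Proof.
rewrite /path_edges /mkseq /= => /(nthP set0)[i].
rewrite size_pairmap size_map size_iota => iN.
rewrite (nth_pairmap (p 0)) ?size_map ?size_iota // => <-; exists i => //.
rewrite (nth_map 0) ?size_iota // nth_iota // add1n.
case: i iN => //= i iN; rewrite (nth_map 0) ?size_iota; last by lia.
by rewrite nth_iota ?add1n //; lia.
Qed.

(** [Q] may depend on the order of its arguments: [pick] fixes one orientation per edge, so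
    disjointness is only required for distinct unordered pairs. *)
Lemma immersion_of_paths n (S : {set G}) (Q : G -> G -> seq G) :
  n <= #|S| ->
  (forall x y, x \in S -> y \in S -> x != y ->
     [/\ is_path (Q x y), path_ends (Q x y) = [set x; y] &
         forall z, z \in path_interior (Q x y) -> z \notin S]) ->
  (forall x y x' y' d, x \in S -> y \in S -> x' \in S -> y' \in S ->
     x != y -> x' != y' -> d \in path_edges (Q x y) ->
     d \in path_edges (Q x' y') -> [set x; y] = [set x'; y']) ->
  contains_immersion G (complete_graph n).
Proof.
move=> nS QP Qdisj.
pose phi (i : complete_graph n) : G := enum_val (widen_ord nS i).
have phi_inj : injective phi.
  by move=> i j /enum_val_inj /(f_equal val) /= /val_inj.
have phiS i : phi i \in S by apply: enum_valP.
pose P (e : {set complete_graph n}) :=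
  if [pick p : complete_graph n * complete_graph n
       | (p.1 != p.2) && (e == [set p.1; p.2])] is Some p
  then Q (phi p.1) (phi p.2) else [::].
have PE e : e \in edges (complete_graph n) -> exists i j,
    [/\ phi i != phi j, e = [set i; j] & P e = Q (phi i) (phi j)].
  rewrite inE => /existsP[i /existsP[j /andP[ij /eqP eij]]].
  rewrite /P; case: pickP => [[i' j'] /= /andP[ij' /eqP eij']|/(_ (i, j))] /=.
    by exists i', j'; rewrite (inj_eq phi_inj).
  by rewrite [i != j]ij eij eqxx.
exists phi, P; split=> //.
- move=> e /PE[i [j [ij -> ->]]].
  have [? -> _] := QP _ _ (phiS i) (phiS j) ij.
  by split=> //; rewrite imsetU1 imset_set1.
- move=> e e' /PE[i [j [ij -> ->]]] /PE[i' [j' [ij' -> ->]]] ne_e d de.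
  apply: contra ne_e => de'.
  have := Qdisj _ _ _ _ d (phiS i) (phiS j) (phiS i') (phiS j') ij ij' de de'.
  have im a b : [set phi a; phi b] = phi @: [set a; b].
    by rewrite imsetU1 imset_set1.
  by rewrite !im => /(imset_inj phi_inj) ->.
- move=> e /PE[i [j [ij _ ->]]] v.
  have [_ _ intP] := QP _ _ (phiS i) (phiS j) ij.
  by apply/negP => /intP; rewrite phiS.
Qed.

Lemma direct_path x y : adj x y ->
  [/\ is_path [:: x; y], path_ends [:: x; y] = [set x; y] &
      path_edges [:: x; y] = [:: [set x; y]]].
Proof.
move=> xy; split=> //; rewrite /is_path /= xy inE.
by move: xy; rewrite adjE => /andP[->].
Qed.

Lemma clique_immersion n (A : {set G}) :
  clique A -> n <= #|A| -> contains_immersion G (complete_graph n).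
Proof.
move=> clA nA; apply: (@immersion_of_paths n A (fun x y => [:: x; y])) => //.
  move=> x y xA yA xy; have [|? ? _] := @direct_path x y.
    by rewrite adjE xy clA.
  by split.
by move=> x y x' y' d _ _ _ _ _ _; rewrite /= !inE => /eqP-> /eqP.
Qed.

End Paths.

(** * Complete graphs immersed in a blow-up of an odd cycle *)

Section BlowupImmersion.

Variables (G : sgraph) (k : nat) (h : G -> nat) (b : nat).
Implicit Types (x y z u v w : G).

Let N := k.*2.+1.

Hypothesis k2 : 2 <= k.
Hypothesis hP :
  forall v w, cadj v w = [|| h v == N, h w == N | cyc N (h v) (h w)].
Hypothesis min0 : forall i, i < N -> #|layer h 0| <= #|layer h i|.
Hypothesis b_le : forall l, 0 < l <= k -> b <= #|layer h l.*2|.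

(** Taking an initial segment bounds the ranks in [B] by [b], so [B] can be copied by rank into each
    even layer other than 0. *)
Let B : {set G} := [set v in take b (enum (layer h 2))].
Let S := layer h 0 :|: layer h 1 :|: layer h N :|: B.

Let inB v : v \in B -> h v = 2 /\ rk h v < b.
Proof.
rewrite inE => vB; have v2 : v \in enum (layer h 2) by apply: mem_take vB.
have hv : h v = 2 by move: v2; rewrite mem_enum inE => /eqP.
by split=> //; rewrite /rk hv -in_take.
Qed.

Let inS v : v \in S -> [\/ h v = 0, h v = 1, h v = N | v \in B].
Proof.
rewrite in_setU => /orP[|vB]; last by constructor 4.
rewrite !inE -orbA => /or3P[]/eqP hv.
- by constructor 1.
- by constructor 2.
- by constructor 3.
Qed.

Let S_out v : v \in S -> 2 < h v < N -> False.
Proof. by move/inS=> [->|->|->|/inB[-> _]]; lia. Qed.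

Let card_S : #|S| = #|layer h 0| + #|layer h 1| + #|layer h N| + b.
Proof.
rewrite /S cardsU card_layers; last by rewrite /= !inE /N; lia.
have -> : (layer h 0 :|: layer h 1 :|: layer h N) :&: B = set0.
  apply/setP => v; rewrite in_setI in_set0; apply/negP => /andP[vL /inB[hv _]].
  by move: vL; rewrite !inE hv /N; lia.
rewrite cards0 subn0 /B; congr addn.
rewrite cardsE (card_uniqP _) ?take_uniq ?enum_uniq //.
by rewrite size_takel // -cardE; apply: (@b_le 1); lia.
Qed.

(** Index [N] closes the cycle at layer 0; it does not denote the dominating layer here. *)
Let lay l := if l == N then 0 else l.

(* Every odd layer other than layer 1 has room for a copy of layer 0, and every
   even layer other than layer 0 for a copy of B; the step from layer l to
   layer l + 1 then remembers both ends of the path, whence edge-disjointness. *)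
Let pt x y i :=
  let l := i.+2 in
  nth x (enum (layer h (lay l))) (if odd l then rk h x else rk h y).

(** The 2k vertices run through layers 2, ..., 2k and then 0, from [y] to [x]. *)
Let long x y := mkseq (pt x y) k.*2.-1.+1.

Section OnePath.

Variables x y : G.
Hypotheses (hx : h x = 0) (yB : y \in B).

(** The default of [nth] is never reached: layer 0 is smallest, and the rank of [y] is below [b]. *)
Let ptP i : i < k.*2 ->
  h (pt x y i) = lay i.+2 /\
  rk h (pt x y i) = if odd i then rk h x else rk h y.
Proof.
move=> ik; rewrite /pt /= negbK; apply: layer_nth.
case: ifP => oi.
  apply: leq_trans (rk_lt h x) _; rewrite hx; apply: min0.
  by rewrite /lay /N; case: eqP; lia.
have [hy yb] := inB yB; apply: leq_trans yb _.
rewrite /lay ifN; last by rewrite /N; lia.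
have -> : i.+2 = (i.+2)./2.*2 by lia.
by apply: b_le; lia.
Qed.

Let pt0 : pt x y 0 = y.
Proof.
have [hy _] := inB yB; have k0 : 0 < k.*2 by lia.
have [h0 r0] := ptP k0; apply: (rk_inj (h := h)) => //.
by rewrite h0 hy /lay /N; case: eqP; lia.
Qed.

Let pt_last : pt x y k.*2.-1 = x.
Proof.
have k0 : k.*2.-1 < k.*2 by lia.
have [h0 r0] := ptP k0; apply: (rk_inj (h := h)) => //.
  by rewrite h0 hx /lay ifT // /N; lia.
by rewrite r0 ifT //; lia.
Qed.

Let pt_inj i j : i <= k.*2.-1 -> j <= k.*2.-1 -> pt x y i = pt x y j -> i = j.
Proof.
move=> ik jk eq_ij.
have [hi _] := @ptP i ltac:(lia); have [hj _] := @ptP j ltac:(lia).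
by move: hi; rewrite eq_ij hj /lay /N; do 2!case: eqP => ?; lia.
Qed.

Lemma long_pathP :
  [/\ is_path (long x y), path_ends (long x y) = [set x; y] &
      forall z, z \in path_interior (long x y) -> z \notin S].
Proof.
split.
- apply: mkseq_path => [i ik|]; last exact: pt_inj.
  rewrite adjE; apply/andP; split.
    by apply/eqP => /pt_inj; lia.
  have [hi _] := @ptP i ltac:(lia); have [hj _] := @ptP i.+1 ltac:(lia).
  rewrite hP hi hj /lay /cyc /N.
  by case: (i.+2 =P k.*2.+1); case: (i.+3 =P k.*2.+1); lia.
- by rewrite mkseq_ends pt0 pt_last setUC.
- move=> z /mkseq_interior[i ik ->]; have [hi _] := @ptP i ltac:(lia).
  apply/negP => /S_out; rewrite hi; apply.
  by rewrite /lay /N; case: eqP => ?; lia.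
Qed.

Lemma long_edgesP d : d \in path_edges (long x y) ->
  exists2 i, i.+1 < k.*2 & exists u v, d = [set u; v] /\
   [/\ h u = i.+2, h v = lay i.+3,
       rk h u = (if odd i then rk h x else rk h y) &
       rk h v = (if odd i then rk h y else rk h x)].
Proof.
case/mkseq_edges=> i ik ->; exists i; first by lia.
have [hi ri] := @ptP i ltac:(lia); have [hj rj] := @ptP i.+1 ltac:(lia).
exists (pt x y i), (pt x y i.+1); split=> //; split=> //.
  by rewrite hi /lay ifN // /N; lia.
by rewrite rj /=; case: (odd i).
Qed.

(** Separates long paths from direct edges, whose ends both lie in [S]. *)
Lemma long_edges_out d : d \in path_edges (long x y) ->
  exists2 z, z \in d & z \notin S.
Proof.
case/long_edgesP=> i ik [u [v [-> [hu hv _ _]]]].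
have [i0|i0] := posnP i.
  exists v; first by rewrite !inE eqxx orbT.
  by apply/negP => /S_out; apply; rewrite hv i0 /lay /N; case: eqP => ?; lia.
exists u; first by rewrite !inE eqxx.
by apply/negP => /S_out; apply; rewrite hu /N; lia.
Qed.

End OnePath.

Lemma long_edges_disjoint x y x' y' d :
  h x = 0 -> y \in B -> h x' = 0 -> y' \in B ->
  d \in path_edges (long x y) -> d \in path_edges (long x' y') ->
  x = x' /\ y = y'.
Proof.
move=> hx yB hx' yB' /(long_edgesP hx yB)[i ik [u [v [-> [hu hv ru rv]]]]].
case/(long_edgesP hx' yB')=> i' ik' [u' [v' [eq_d [hu' hv' ru' rv']]]].
have uv : u != v.
  by apply/eqP => euv; move: hu; rewrite euv hv /lay /N; case: eqP; lia.
have u_in : (u == u') || (u == v') by rewrite -in_set2 -eq_d set21.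
have v_in : (v == u') || (v == v') by rewrite -in_set2 -eq_d set22.
(* A crosswise match would require i = i' + 1 and i' = i + 1, since [u] and [u'] are not in layer
   0. *)
have [eu ev] : u = u' /\ v = v'.
  case/orP: u_in => /eqP eu; case/orP: v_in => /eqP ev //.
  - by rewrite eu ev eqxx in uv.
  - move: hu hv; rewrite eu ev hu' hv' /lay /N.
    by do 2!case: eqP => ?; lia.
  - by rewrite eu ev eqxx in uv.
have ii : i = i' by move: hu; rewrite eu hu'; lia.
move: ru rv; rewrite eu ev ru' rv' ii.
have [hy _] := inB yB; have [hy' _] := inB yB'.
by case: (odd i') => r1 r2; split; apply: (rk_inj (h := h));
   rewrite ?hx ?hx' ?hy ?hy'.
Qed.

Lemma blowup_immersion n :
  n <= #|layer h 0| + #|layer h 1| + #|layer h N| + b ->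
  contains_immersion G (complete_graph n).
Proof.
pose Q x y :=
  if (h x == 0) && (y \in B) then long x y
  else if (h y == 0) && (x \in B) then long y x else [:: x; y].
rewrite -card_S => nS.
have QP x y : x \in S -> y \in S -> x != y ->
    [\/ [/\ h x = 0, y \in B & Q x y = long x y],
        [/\ h y = 0, x \in B & Q x y = long y x] |
        adj x y /\ Q x y = [:: x; y]].
  move=> xS yS xy; rewrite /Q.
  case: ifP => [/andP[/eqP hx yB]|n1]; first by constructor 1.
  case: ifP => [/andP[/eqP hy xB]|n2]; first by constructor 2.
  constructor 3; split=> //; rewrite adjE xy hP.
  move: n1 n2; case/inS: xS => [hx|hx|hx|xB]; case/inS: yS => [hy|hy|hy|yB];
    rewrite ?hx ?hy ?eqxx ?orbT ?xB ?yB //= => _ _.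
  all: try by rewrite (proj1 (inB yB)) /cyc; lia.
  all: try by rewrite (proj1 (inB xB)) /cyc; lia.
  by rewrite (proj1 (inB xB)) (proj1 (inB yB)) /cyc; lia.
apply: (@immersion_of_paths _ _ S Q) => //.
  move=> x y xS yS xy.
  have [[hx yB ->]|[hy xB ->]|[axy ->]] := QP _ _ xS yS xy.
  - exact: long_pathP.
  - by have [? ? ?] := long_pathP hy xB; rewrite setUC.
  - by have [] := direct_path axy.
move=> x y x' y' d xS yS xS' yS' xy xy'.
have direct_out u v a c : u \in S -> v \in S -> h a = 0 -> c \in B ->
    d \in [:: [set u; v]] -> d \in path_edges (long a c) -> False.
  move=> uS vS ha cB; rewrite inE => /eqP-> /(long_edges_out ha cB)[z].
  by rewrite in_set2 => /orP[]/eqP->; rewrite ?uS ?vS.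
have [[hx yB ->]|[hy xB ->]|[axy ->]] := QP _ _ xS yS xy;
have [[hx' yB' ->]|[hy' xB' ->]|[axy' ->]] := QP _ _ xS' yS' xy' => d1 d2.
- by have [-> ->] := long_edges_disjoint hx yB hx' yB' d1 d2.
- by have [-> ->] := long_edges_disjoint hx yB hy' xB' d1 d2; rewrite setUC.
- by case: (direct_out _ _ _ _ xS' yS' hx yB d2 d1).
- by have [-> ->] := long_edges_disjoint hy xB hx' yB' d1 d2; rewrite setUC.
- by have [-> ->] := long_edges_disjoint hy xB hy' xB' d1 d2.
- by case: (direct_out _ _ _ _ xS' yS' hy xB d2 d1).
- by case: (direct_out _ _ _ _ xS yS hx' yB' d1 d2).
- by case: (direct_out _ _ _ _ xS yS hy' xB' d1 d2).
- by move: d1 d2; rewrite !inE => /eqP<- /eqP<-.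
Qed.

End BlowupImmersion.

(** * The clique, chordal and blow-up cases combined *)

Theorem theorem1p5 (G : sgraph) :
  2 <= alpha G ->
  (forall l : nat, 4 <= l -> l <= 2 * alpha G ->
     ~ contains_induced G (cycle_graph l)) ->
  contains_immersion G (complete_graph (chi G)).
Proof.
move=> alpha2 no_cycle; set N := (alpha G).*2.+1.
have no_hole l f : 4 <= l -> l < N -> ~ @hole G l f.
  move=> l4 lN /(hole_induced l4); apply: no_cycle => //.
  by rewrite /N in lN; lia.
have not_col c : c < chi G -> ~ colorable G c.
  by rewrite /chi; case: ex_minnP => m _ m_min cm /m_min; rewrite leqNgt cm.
have [/existsP[A /andP[/forall_inP clA cA]]|no_clique] :=
  boolP [exists A : {set G},
           [forall x in A, [forall y in A, cadj x y]] && (chi G <= #|A|)].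
  by apply: (clique_immersion _ cA) => x y /clA/forall_inP; apply.
have clique_lt (A : {set G}) : clique A -> #|A| < chi G.
  move=> clA; rewrite ltnNge; apply: contra no_clique => cA.
  apply/existsP; exists A; rewrite cA andbT.
  by apply/forall_inP => x xA; apply/forall_inP => y yA; apply: clA.
have chi0 : 0 < chi G.
  by have := clique_lt set0; rewrite cards0; apply=> x y; rewrite inE.
have clique_c (A : {set G}) : clique A -> #|A| <= (chi G).-1.
  by move=> /clique_lt; lia.
have notc : ~ colorable G (chi G).-1 by apply: not_col; lia.
(* Without a hole of length [N] there would be none at all, and the chordal case would colour [G]
   with chi - 1 colours. *)
have [f hf] : exists f, @hole G N f.
  have [/existsP[g /forallP gP]|no_g] := boolP [exists g : {ffun 'I_N -> G},
      [forall i : 'I_N, [forall j : 'I_N, cadj (g i) (g j) == cyc N i j]]].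
    exists (fun i => g (inord i)) => i j iN jN.
    by have /forallP/(_ (inord j))/eqP := gP (inord i); rewrite !inordK.
  case: notc; apply: chordal_colorable => // l f l4 hf.
  have [lN|lN] := ltnP l N; first exact: no_hole hf.
  have lN' : l = N by apply/eqP; rewrite eqn_leq lN (hole_alpha l4 hf).
  rewrite lN' in hf.
  case/existsP: no_g; exists [ffun i : 'I_N => f i].
  apply/forallP => i; apply/forallP => j; rewrite !ffunE.
  by rewrite hf.
have [h [hN hP]] := blowup_of_hole alpha2 no_hole hf.
have [i0 i0_min] : exists i0 : 'I_N,
    forall i : 'I_N, #|layer h i0| <= #|layer h i|.
  exists [arg min_(i < ord0) #|layer h i|].
  by case: arg_minnP => // i _ + j; apply.
(* Rotation by [N - i0] carries layer [i0] to position 0. *)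
have i0N : N - i0 <= N by lia.
pose h' v := if h v == N then N else shift N (N - i0) (h v).
have [hN' hP'] : (forall v, h' v <= N) /\ forall v w,
    cadj v w = [|| h' v == N, h' w == N | cyc N (h' v) (h' w)].
  exact: rotate_layers.
have layerE i : i < N -> layer h' i = layer h (shift N i0 i).
  move=> iN; apply/setP => v; rewrite !inE /h'.
  case: (eqVneq (h v) N) => [->|hv].
    by rewrite !(eq_sym N) !ltn_eqF ?shift_lt ?ltn_ord // ltnW.
  have hvN : h v < N by rewrite ltn_neqAle hv hN.
  by apply/eqP/eqP => [<-|->]; rewrite (shiftK, shiftVK) //; apply/ltnW.
have min0 i : i < N -> #|layer h' 0| <= #|layer h' i|.
  move=> iN; have sN : shift N i0 i < N by apply: shift_lt => //; apply: ltnW.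
  rewrite !layerE // {1}/shift add0n ltn_ord.
  exact: (i0_min (Ordinal sN)).
set n0 := #|layer h' 0|; set n1 := #|layer h' 1|; set nN := #|layer h' N|.
(* Layers 0, 1 and [N] form a clique, so the subtraction defining [b] below is not truncated. *)
have cliques : n0 + n1 + nN < chi G.
  rewrite -card_layers; last by rewrite /= !inE /N; lia.
  by apply: clique_lt; apply: (layers_clique hP'); rewrite /cyc.
apply: (@blowup_immersion _ _ h' (chi G - (n0 + n1 + nN)) alpha2 hP' min0).
  (* An even layer with fewer than [b] vertices would satisfy [four_c] with chi - 1 colours. *)
  move=> l lk; rewrite leqNgt; apply/negP => bl; apply: notc.
  apply: (@blowup_colorable _ _ h' alpha2 hN' hP' _ l clique_c lk).
  by rewrite -/N -/n0 -/n1 -/nN; lia.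
by rewrite -/N -/n0 -/n1 -/nN; lia.
Qed.
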